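(* Let $G$ be a sharply $2$-transitive permutation group on a set $X$, of permutation characteristic $0$, whose point stabilizer is virtually abelian (i.e. has an abelian subgroup of finite index). Then $G$ splits, i.e. $G$ has a normal subgroup $N$ which acts regularly on $X$.
   Context: A permutation group $G$ on a set $X$ with at least two elements is sharply $2$-transitive if for any two pairs $(x,y)$ and $(x',y')$ of distinct elements of $X$ (that is, $x\neq y$ and $x'\neq y'$) there is a unique $g\in G$ with $gx=x'$ and $gy=y'$. Such a $G$ has involutions (elements of order $2$). Either involutions have no fixed points, and $G$ has permutation characteristic $2$; or involutions have fixed points, and then the action of $G$ on $X$ is equivalent to the conjugation action of $G$ on its set $I$ of involutions. In the latter case all translations, i.e. products of two distinct involutions, are conjugate and have the same order $p$, which is an odd prime or $\infty$; the permutation characteristic of $G$ is $p$ if $p$ is finite and $0$ if $p=\infty$. Thus $G$ has permutation characteristic $0$ if its involutions have fixed points and the product of any two distinct involutions has infinite order. A subgroup acts regularly on $X$ if it acts transitively with trivial point stabilizers. *)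

(* Defs.v *)
From mathcomp Require Import all_boot.
From mathcomp Require Import boolp classical_sets functions cardinality.

Set Implicit Arguments.
Unset Strict Implicit.
Unset Printing Implicit Defensive.

Local Open Scope classical_set_scope.
Local Open Scope group_scope.

(* A permutation group on [X] is a (possibly infinite) group with a faithful
   left action on [X]. *)
Definition is_action (G : groupType) (X : Type) (act : G -> X -> X) : Prop :=
  (forall x, act 1 x = x) /\
  (forall g h x, act (g * h) x = act g (act h x)).

Definition permutation_group (G : groupType) (X : Type)
    (act : G -> X -> X) : Prop :=
  is_action act /\ (forall g, (forall x, act g x = x) -> g = 1).

(* Meaningful only when [X] has at least two elements, which is a separate
   hypothesis wherever this is used. *)
Definition sharply_2_transitive (G : groupType) (X : Type)
    (act : G -> X -> X) : Prop :=
  forall x y x' y' : X, x <> y -> x' <> y' ->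
    exists! g : G, act g x = x' /\ act g y = y'.

Definition involution (G : groupType) (g : G) : Prop := g <> 1 /\ g ^+ 2 = 1.

Definition infinite_order (G : groupType) (g : G) : Prop :=
  forall n : nat, (0 < n)%N -> g ^+ n <> 1.

(* Intended for sharply 2-transitive groups, which always have involutions. *)
Definition perm_char_0 (G : groupType) (X : Type) (act : G -> X -> X) : Prop :=
  (forall i : G, involution i -> exists x, act i x = x) /\
  (forall i j : G, involution i -> involution j -> i <> j ->
     infinite_order (i * j)).

Definition stabilizer (G : groupType) (X : Type) (act : G -> X -> X) (x : X) :
  set G := [set g | act g x = x].

Definition is_subgroup (G : groupType) (H : set G) : Prop :=
  group_closed (mem H).

Definition is_normal (G : groupType) (N : set G) : Prop :=
  is_subgroup N /\ (forall g n : G, N n -> N (n ^ g)).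

Definition is_abelian (G : groupType) (H : set G) : Prop :=
  forall g h : G, H g -> H h -> commute g h.

Definition left_coset (G : groupType) (g : G) (H : set G) : set G :=
  [set g * h | h in H].

(* Finitely many left cosets [g * H] with [g] in [K]; used for [H `<=` K]. *)
Definition finite_index (G : groupType) (K H : set G) : Prop :=
  finite_set [set left_coset g H | g in K].

Definition virtually_abelian (G : groupType) (K : set G) : Prop :=
  exists A : set G,
    [/\ is_subgroup A, A `<=` K, is_abelian A & finite_index K A].

Definition acts_regularly (G : groupType) (X : Type) (act : G -> X -> X)
    (N : set G) : Prop :=
  (forall x y : X, exists2 g, N g & act g x = y) /\
  (forall x : X, N `&` stabilizer act x = [set 1]).

Definition splits (G : groupType) (X : Type) (act : G -> X -> X) : Prop :=
  exists N : set G, is_normal N /\ acts_regularly act N.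

(* Main.v *)
Require Import Defs.
From mathcomp Require Import all_boot.
From mathcomp Require Import boolp classical_sets functions cardinality.
From mathcomp Require Import zify.

(** Because involutions have fixed points, each point of [X] is fixed by exactly
    one involution, and [X] can be replaced by the set of involutions on which
    [G] acts by conjugation, sharply 2-transitively ([sharp_involutions]).  A
    translation is a product of two distinct involutions.  The group splits as
    soon as every involution inverts every translation: then a product of three
    involutions is an involution, and the products of two involutions form the
    regular normal subgroup ([splits_of_inverted_translations]).

    Fix an involution [i], a translation [t] inverted by [i], and for [n > 0]
    the element [c n] of the centralizer of [i] that conjugates [t] to
    [t ^+ n].  An abelian subgroup [A] of finite index in the centralizer of [i]
    colours the positive integers by the cosets [c n * A]; van der Waerden's
    theorem for progressions of length three provides [b < h < a] with
    [b + a = h + h] in one colour.  The elements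
        [c = (c a)^-1 * c b * i]    and    [e = (c a)^-1 * c h]
    act on the powers of [t] as multiplication by [- b / a] and by [h / a], and
    both have only finitely many conjugates under the centralizer of [i], since
    [A] is abelian of finite index.  Put [y = i * t ^+ (a + a)].  In a split
    group the dilations [c_xy] with centre [x] and [c_yx] with centre [y] of
    the same factor [- b / a] differ by the translation by [1 + b / a = 2 h / a]
    times the vector from [x] to [y], up to a sign; here this reads
        [c_yx = c_xy * x * y ^ e_xy]                 ([dilation_relation]).
    By 2-transitivity the equation holds for all pairs of involutions, where
    [c_xy] and [e_xy] range over finite sets depending on [x] only.

    If [c_yx = c_yx'] for two involutions [x] and [x'], the equation shows that
    the translation [y ^ e_xy * y ^ e_x'y] is equal to
    [x * c_xy^-1 * c_x'y * x'], one of finitely many elements once [x] and [x']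
    are taken from a finite list; and it is inverted by [y ^ e_xy].  A
    list of [x]'s that is longer than the number of possible values of [c_yx]
    always contains such a pair, so all but finitely many involutions invert one
    of finitely many translations ([finite_cover]).

    Translations can be divided by every positive integer.  A pigeonhole
    argument on the rational points of the line through two involutions improves
    the covering: any two involutions invert a common member of the finite list
    of translations ([common_inverted]).  Members of the list that are not
    inverted by all involutions can then be removed one at a time
    ([inverted_by_all]).  What remains is a translation inverted by all
    involutions, and all translations are conjugate to it. *)

(** * Pigeonholes and arithmetic progressions *)

Lemma pigeonhole (T : eqType) (s : seq T) (f : nat -> T) :
  (forall n, n <= size s -> f n \in s) ->
  exists n m, [/\ n < m, m <= size s & f n = f m].
Proof.
move=> fs; pose t := [seq f n | n <- iota 0 (size s).+1].
have szt : size t = (size s).+1 by rewrite size_map size_iota.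
have [ut|] := boolP (uniq t).
  have : size t <= size s.
    apply: uniq_leq_size => // x /mapP [n]; rewrite mem_iota => /andP[_ lt_n] ->.
    exact: fs.
  by rewrite szt ltnn.
move=> /(uniqPn (f 0)) [n [m [lt_nm]]]; rewrite szt => lt_m.
have nth_t l : l < (size s).+1 -> nth (f 0) t l = f l.
  by move=> lt_l; rewrite (nth_map 0) ?size_iota // nth_iota // add0n.
rewrite !nth_t //; last exact: ltn_trans lt_m.
by exists n, m.
Qed.

(** Some window of [W] consecutive values recurs; the bound [B] does not depend
    on where the search starts, which is what the focusing argument iterates. *)
Lemma window_recurrence (C : finType) (f : nat -> C) W :
  exists B, forall s, exists p D,
    [/\ s <= p, 0 < D, p + D <= s + B
      & forall x, x < W -> f (p + x) = f (p + D + x)].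
Proof.
pose F (n : nat) : {ffun 'I_W -> C} := [ffun x : 'I_W => f (n + x)].
exists (size (enum {ffun 'I_W -> C})) => s.
have [n [m [lt_nm le_m eqF]]] :=
  @pigeonhole _ (enum {ffun 'I_W -> C}) (fun n => F (s + n))
    (fun n _ => mem_enum _ _).
move: (size _) le_m => B le_m.
exists (s + n), (m - n); split; [lia | lia | lia |] => x lt_x.
have /ffunP/(_ (Ordinal lt_x)) := eqF; rewrite !ffunE /= => ->.
by congr (f _); lia.
Qed.

(** Colour focusing: [k] two-term progressions [F - 2d, F - d] of pairwise
    distinct colours all continue to the same number [F].  Two copies, at
    distance [D], of a window that contains [k] of them yield [k.+1] of them
    with focus [F + 2D]: the old differences grow by [D], and [F, F + D] is the
    new progression.  The bound [W] uniform in [s] makes the window finite. *)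
Lemma colour_focusing (C : finType) (f : nat -> C) k :
  (forall a d, 0 < d -> f a = f (a + d) -> f (a + d) <> f (a + d + d)) ->
  exists W, forall s, exists F ds,
    [/\ s <= F, F < s + W, size ds = k,
        forall d, d \in ds ->
          [/\ 0 < d, s + d + d <= F & f (F - d) = f (F - d - d)]
      & uniq [seq f (F - d) | d <- ds]].
Proof.
move=> noAP; elim: k => [|k [W IHW]].
  by exists 1 => s; exists s, [::]; split => //; lia.
have [B HB] := window_recurrence C f W.
exists (B + B + W) => s.
have [p [D [le_sp D_gt0 le_pD rec]]] := HB s.
have [F [ds [le_F lt_F sz_ds dsP u_ds]]] := IHW p.
(* Seen from the new focus, the point at distance [d + D] lies in the second
   copy of the window, above the old point at distance [d] from [F]. *)
have near d : d \in ds -> f (F + D + D - (d + D)) = f (F - d).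
  move=> /dsP [d_gt0 le_d _].
  have -> : F + D + D - (d + D) = p + D + (F - d - p) by lia.
  by rewrite -rec; [congr (f _); lia | lia].
have nearF : f (F + D + D - D) = f F.
  have -> : F + D + D - D = p + D + (F - p) by lia.
  by rewrite -rec; [congr (f _); lia | lia].
exists (F + D + D), (D :: [seq d + D | d <- ds]); split; [lia | lia | | |].
- by rewrite /= size_map sz_ds.
- move=> d; rewrite inE => /orP [/eqP -> | /mapP [e e_ds ->]].
    by rewrite nearF; split; [lia | lia | congr (f _); lia].
  have [e_gt0 le_e f_e] := dsP e e_ds.
  by rewrite near // f_e; split; [lia | lia | congr (f _); lia].
rewrite /= nearF -map_comp.
have -> : [seq ((fun d => f (F + D + D - d)) \o (fun d => d + D)) d | d <- ds]
        = [seq f (F - d) | d <- ds].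
  by apply/eq_in_map => d /near.
(* If [F] had an old colour, the old progression of that colour would extend
   to length three. *)
rewrite u_ds andbT; apply/negP => /mapP [d /dsP [d_gt0 le_d f_d] f_F].
apply: (noAP (F - d - d) d d_gt0).
  by rewrite -f_d; congr (f _); lia.
have -> : F - d - d + d = F - d by lia.
by rewrite -f_F; congr (f _); lia.
Qed.

(** More focused progressions than colours cannot exist. *)
Lemma monochromatic_3AP (C : finType) (f : nat -> C) :
  exists a d, [/\ 0 < d, f a = f (a + d) & f (a + d) = f (a + d + d)].
Proof.
apply: contrapT => noAP.
have [|W /(_ 0) [F [ds [_ _ sz_ds _ u_ds]]]] := colour_focusing C f #|C|.+1.
  by move=> a d d_gt0 eq1 eq2; apply: noAP; exists a, d.
have := max_card (mem [seq f (F - d) | d <- ds]).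
by rewrite (card_uniqP u_ds) size_map sz_ds ltnn.
Qed.

(** Shifting such a set by a common multiple [P] of its elements and differences
    keeps the property and makes room for the new element [P]. *)
Lemma difference_dividing_set k :
  exists s : seq nat, [/\ size s = k, uniq s, 0 \notin s
    & forall u v, u \in s -> v \in s -> u < v -> v - u %| u].
Proof.
elim: k => [|k [s [sz_s u_s s0 sP]]]; first by exists [::].
pose P := (\max_(u <- s) u)`!.
have P_gt0 : 0 < P by apply: fact_gt0.
have le_max u : u \in s -> u <= \max_(u <- s) u.
  by move=> us; apply: leq_bigmax_seq.
have dvdP d u : u \in s -> 0 < d -> d <= u -> d %| P.
  move=> us d_gt0 le_d; apply: dvdn_fact; rewrite d_gt0.
  exact: leq_trans le_d (le_max u us).
have s_gt0 u : u \in s -> 0 < u by case: u => // us; rewrite us in s0.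
exists (P :: [seq P + u | u <- s]); split.
- by rewrite /= size_map sz_s.
- rewrite /= map_inj_uniq ?u_s ?andbT; last by move=> u v; lia.
  by apply/mapP => -[u /s_gt0]; lia.
- rewrite inE negb_or; apply/andP; split; first by lia.
  by apply/mapP => -[u _]; lia.
move=> u v; rewrite !inE.
case/orP => [/eqP -> | /mapP [u' us ->]]; case/orP => [/eqP -> | /mapP [v' vs ->]].
- by rewrite ltnn.
- by move=> _; rewrite addKn; apply: (dvdP v' v'); rewrite ?s_gt0.
- by lia.
rewrite ltn_add2l subnDl => lt_uv; rewrite dvdn_addl; last exact: sP.
by apply: (dvdP _ v' vs); [lia | lia].
Qed.

Local Open Scope group_scope.

(** * Involutions and the translations they invert *)

Section Reflections.
Context {G : groupType}.
Implicit Types (g h i j k t : G) (n m : nat).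

Definition inverts k t : Prop := t ^ k = t^-1.

Definition translation t : Prop :=
  exists i j, [/\ involution i, involution j, i <> j & t = i * j].

Lemma involution_mulgg i : involution i -> i * i = 1.
Proof. by case. Qed.

Lemma involution_invg i : involution i -> i^-1 = i.
Proof. by move=> /involution_mulgg ii; apply: mulg1_eq. Qed.

Lemma involutionJ i g : involution i -> involution (i ^ g).
Proof.
move=> [i1 ii]; split; last by rewrite -conjXg ii conj1g.
by move=> /eqP; rewrite conjg_eq1 => /eqP.
Qed.

Lemma inverts_mulg i j : involution i -> involution j -> inverts i (i * j).
Proof.
move=> Ii Ij; rewrite /inverts conjgE invgM !involution_invg // !mulgA.
by rewrite involution_mulgg // mul1g.
Qed.

Lemma invertsX k t n : inverts k t -> inverts k (t ^+ n).
Proof. by rewrite /inverts conjXg => ->; rewrite expVgn. Qed.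

Lemma invertsJ k t g : inverts k t -> inverts (k ^ g) (t ^ g).
Proof. by rewrite /inverts -conjJg => ->; rewrite conjVg. Qed.

Lemma infinite_order_expg_inj t n m : infinite_order t -> t ^+ n = t ^+ m -> n = m.
Proof.
move=> ot; wlog le_nm : n m / n <= m.
  by move=> hw e; case: (leqP n m) => [|/ltnW] l; [|symmetry]; apply: hw.
move=> e; apply/eqP; rewrite eqn_leq le_nm -subn_eq0.
have : t ^+ (m - n) = 1 by rewrite expgnFr // e mulgV.
by case: (m - n)%N => // d /(ot d.+1 (ltn0Sn _)).
Qed.

(** If [k = t ^+ n], then [k] commutes with [t] and inverts it, so that
    [t ^+ 2 = 1]. *)
Lemma involution_mulX k t n :
  involution k -> inverts k t -> infinite_order t -> involution (k * t ^+ n).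
Proof.
move=> Ik kt ot; have := invertsX k t n kt; rewrite /inverts conjgE => ktn.
split; last first.
  by move: ktn; rewrite (involution_invg k Ik) => ktn;
  rewrite expg2 !mulgA -(mulgA k) ktn mulVg.
move=> /mulg1_eq e; have := kt.
have -> : k = t ^+ n by rewrite -(involution_invg k Ik).
rewrite /inverts conjgE -expgS expgSr mulKg => tt.
by apply: (ot 2) => //; rewrite expg2 {1}tt mulVg.
Qed.

End Reflections.

(** Sharp 2-transitivity in characteristic 0, expressed for the conjugation
    action on the involutions, with uniqueness stated for the identity. *)
Record sharp_involutions (G : groupType) : Prop := SharpInvolutions {
  translation_order : forall i j : G,
    involution i -> involution j -> i <> j -> infinite_order (i * j);
  involution_2trans : forall i j i' j' : G,
    involution i -> involution j -> involution i' -> involution j' ->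
    i <> j -> i' <> j' -> exists g, i ^ g = i' /\ j ^ g = j';
  involution_free : forall i j g : G,
    involution i -> involution j -> i <> j -> i ^ g = i -> j ^ g = j -> g = 1
}.

Section Sharp.
Context {G : groupType} (sG : sharp_involutions G).
Implicit Types (g h i j k t : G) (n m : nat) (L ts : seq G).

Lemma involution_dilate i j n :
  involution i -> involution j -> i <> j -> involution (i * (i * j) ^+ n).
Proof.
move=> Ii Ij ij; apply: involution_mulX => //; first exact: inverts_mulg.
exact: (translation_order _ sG).
Qed.

Lemma dilate_inj i j n m : involution i -> involution j -> i <> j ->
  i * (i * j) ^+ n = i * (i * j) ^+ m -> n = m.
Proof.
move=> Ii Ij ij /mulgI; apply: infinite_order_expg_inj.
exact: (translation_order _ sG).
Qed.

(** Conjugation by an element fixing [i] and taking [i * (i * j) ^+ n] to [j]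
    turns the [n]-th power of [i * j] into [i * j] itself. *)
Lemma translation_root i j n : involution i -> involution j -> i <> j -> 0 < n ->
  exists k, [/\ involution k, i <> k & (i * k) ^+ n = i * j].
Proof.
move=> Ii Ij ij n_gt0.
have ne : i <> i * (i * j) ^+ n.
  move=> e; suff : 0 = n by move=> n0; rewrite -n0 in n_gt0.
  by apply: (dilate_inj i j) => //; rewrite expg0 mulg1.
have [g [ig jg]] := involution_2trans _ sG _ _ _ _
  Ii (involution_dilate i j n Ii Ij ij) Ii Ij ne ij.
exists (j ^ g); split; first exact: involutionJ.
  by rewrite -{1}ig => /conjg_inj.
have -> : i * j ^ g = (i * j) ^ g by rewrite conjMg ig.
rewrite -conjXg -{2}jg conjMg ig.
by rewrite mulgA involution_mulgg // mul1g.
Qed.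

(** The involutions [i * k ^+ n] are points of a line.  Those inverting [t] that
    lie at [u] and [v] differ by [k ^+ (v - u)], which therefore commutes with
    [t]; the divisibilities say that [0] and [N] are reached from [u] by
    steps of length [v - u]. *)
Lemma inverts_both_ends i k t u v N :
  involution i -> inverts i k -> u < v -> (v - u %| u)%N -> (v - u %| N)%N ->
  inverts (i * k ^+ u) t -> inverts (i * k ^+ v) t ->
  inverts i t /\ inverts (i * k ^+ N) t.
Proof.
move=> Ii ik lt_uv dvd_u dvd_N tu tv.
have tuV : t ^ (i * k ^+ u)^-1 = t^-1.
  by apply: (conjg_inj (i * k ^+ u)); rewrite conjgKV conjVg tu invgK.
have comm n : (v - u %| n)%N -> t ^ (k ^+ n) = t.
  move=> /dvdnP [q ->]; rewrite mulnC expgnA.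
  have commd : t ^ (k ^+ (v - u)) = t.
    have -> : k ^+ (v - u) = (i * k ^+ u)^-1 * (i * k ^+ v).
      by rewrite invgM -mulgA mulKg -{2}(subnKC (ltnW lt_uv)) expgnDr mulKg.
    by rewrite conjgM tuV conjVg tv invgK.
  elim: q => [|q IHq]; first by rewrite expg0 conjg1.
  by rewrite expgS conjgM commd.
have ti : inverts i t.
  apply: (conjg_inj (k ^+ u)); rewrite -conjgM tu conjVg comm //.
by split=> //; rewrite /inverts conjgM ti conjVg comm.
Qed.

(** * Dilations with finite conjugacy classes *)

Definition centralizer i : set G := [set g | i ^ g = i].

Lemma centralizerM i g h : i ^ g = i -> i ^ h = i -> i ^ (g * h) = i.
Proof. by move=> ig ih; rewrite conjgM ig. Qed.

Lemma centralizerV i g : i ^ g = i -> i ^ g^-1 = i.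
Proof. by move=> ig; rewrite -{1}ig conjgK. Qed.

Lemma conjg_fix_sym g h : g ^ h = g -> h ^ g = h.
Proof. by move=> /conjg_fixP; rewrite commg1_sym => /conjg_fixP. Qed.

Lemma left_coset_eq (A : set G) g h :
  is_subgroup A -> left_coset g A = left_coset h A -> A (g^-1 * h).
Proof.
move=> [A1 _] e.
have : left_coset h A h by exists 1; rewrite ?mulg1 //; apply/set_mem.
by rewrite -e => -[a Aa <-]; rewrite mulKg.
Qed.

(** For [g] in [K] the conjugate [a ^ g] depends only on the coset
    [g^-1 * A], because [A] is abelian. *)
Lemma finite_conjugates (K A : set G) a :
  is_subgroup A -> is_abelian A -> finite_index K A -> A a ->
  (forall g, K g -> K g^-1) ->
  exists s : seq G, forall g, K g -> a ^ g \in s.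
Proof.
move=> [A1 _] abA finK Aa KV.
pose F (S : set G) := xget 1 [set b | exists2 h, S h & b = a ^ h^-1]%classic.
have /finite_seqP [s sP] := finite_image F finK.
exists s => g Kg; have Kg' := KV g Kg.
have FE : F (left_coset g^-1 A) = a ^ g.
  rewrite /F; case: xgetP => [b _ /= [h [x Ax <-] ->]|].
    rewrite invgM invgK conjgM.
    suff -> : a ^ x^-1 = a by [].
    by apply: (conjg_inj x); rewrite conjgKV conjgE (abA _ _ Aa Ax) mulKg.
  move=> /(_ (a ^ g)) /=; case; exists g^-1; last by rewrite invgK.
  by exists 1; rewrite ?mulg1 //; apply/set_mem.
suff : [set` s]%classic (F (left_coset g^-1 A)) by rewrite FE.
by rewrite -sP; exists (left_coset g^-1 A) => //; exists g^-1.
Qed.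

Lemma power_conjugators i j : involution i -> involution j -> i <> j ->
  exists c : nat -> G, forall n, 0 < n ->
    i ^ c n = i /\ (i * j) ^ c n = (i * j) ^+ n.
Proof.
move=> Ii Ij ij.
suff /choice [c cP] : forall n, exists g,
    0 < n -> i ^ g = i /\ (i * j) ^ g = (i * j) ^+ n by exists c.
case=> [|n]; first by exists 1.
have ne : i <> i * (i * j) ^+ n.+1.
  by rewrite -{1}[i]mulg1 -(expg0 (i * j)) => /dilate_inj e; have := e Ii Ij ij.
have [g [ig jg]] := involution_2trans _ sG _ _ _ _
  Ii Ij Ii (involution_dilate i j n.+1 Ii Ij ij) ij ne.
by exists g; split=> //; rewrite conjMg ig jg mulgA involution_mulgg // mul1g.
Qed.

(** Colour [n] by the coset of [c n], and take a monochromatic three-term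
    progression. *)
Lemma left_cosets_3AP (K A : set G) (c : nat -> G) :
  is_subgroup A -> finite_index K A -> (forall n, 0 < n -> K (c n)) ->
  exists a d, [/\ 0 < a, 0 < d, A ((c (a + d + d))^-1 * c a)
                & A ((c (a + d + d))^-1 * c (a + d))].
Proof.
move=> sA /finite_seqP [s sP] Kc.
(* Indexing by [n.+1] keeps the progression positive, as [c 0] is arbitrary. *)
pose f n : 'I_(size s).+1 := inord (index (left_coset (c n.+1) A) s).
have fE n m : f n = f m -> left_coset (c n.+1) A = left_coset (c m.+1) A.
  have ms l : left_coset (c l.+1) A \in s.
    suff : [set` s]%classic (left_coset (c l.+1) A) by [].
    by rewrite -sP; exists (c l.+1) => //; apply: Kc.
  move=> /(congr1 (@nat_of_ord _)).
  rewrite /f !inordK ?ltnS ?index_size // => e.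
  by rewrite -(nth_index set0 (ms n)) e nth_index.
have [a [d [d_gt0 f1 f2]]] := monochromatic_3AP _ f.
exists a.+1, d; rewrite !addSn.
by split=> //; apply: left_coset_eq => //; apply: fE; rewrite ?f1.
Qed.

(** Let [b < h < a] be the progression of [left_cosets_3AP] for the cosets of
    [A], and let [y = i * (i * j) ^+ (a + a)].  The translation [(i * j) ^+ a]
    moves [i] to [y], and [k = i * (i * j) ^+ a] is the point reflection in the
    middle of [i] and [y].  As [c] acts on the powers of
    [i * j] like multiplication by [- b / a], conjugating [c] by that
    translation multiplies it by [(i * j) ^+ (a + b)]; since [a + b = 2h], this
    is [i * y ^ e], with [e] acting like multiplication by [h / a].  The
    progression is nontrivial, so the factor [- b / a] is not [-1] and [c] is
    not [i]. *)
Lemma dilation_relation i j (A : set G) :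
  involution i -> involution j -> i <> j ->
  is_subgroup A -> is_abelian A -> (A `<=` centralizer i)%classic ->
  finite_index (centralizer i) A ->
  exists y k c e, [/\ [/\ involution y, i <> y & c <> i],
    [/\ i ^ c = i & i ^ e = i],
    [/\ i ^ k = y, y ^ k = i & c ^ k = c * i * y ^ e],
    (exists s : seq G, forall g, i ^ g = i -> c ^ g \in s)
    & (exists s : seq G, forall g, i ^ g = i -> e ^ g \in s)].
Proof.
move=> Ii Ij ij sA abA Ai finA.
have [c cP] := power_conjugators i j Ii Ij ij.
have [|b [d [b_gt0 d_gt0 Ab Ah]]] := left_cosets_3AP _ _ c sA finA.
  by move=> n /cP [].
pose h := b + d; pose a := b + d + d; pose t := i * j.
rewrite -/a -/h in Ab Ah.
have a_gt0 : 0 < a by rewrite /a; lia.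
have h_gt0 : 0 < h by rewrite /h; lia.
have [ica tca] := cP a a_gt0; have [icb tcb] := cP b b_gt0.
have [ich tch] := cP h h_gt0.
have it : t ^ i = t^-1 by apply: inverts_mulg.
have tV : (t ^+ a) ^ (c a)^-1 = t by rewrite -tca conjgK.
set u := (c a)^-1 * c b in Ab; set e := (c a)^-1 * c h in Ah.
have iu : i ^ u = i by apply: Ai.
have ie : i ^ e = i by apply: Ai.
have tau : (t ^+ a) ^ u = t ^+ b by rewrite conjgM tV.
have tae : (t ^+ a) ^ e = t ^+ h by rewrite conjgM tV.
have ii := involution_mulgg i Ii.
have iii : i ^ i = i by rewrite conjgE mulKg.
have Ik : involution (i * t ^+ a) by apply: involution_dilate.
have ik : i ^ (i * t ^+ a) = i * t ^+ (a + a).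
  rewrite conjgM iii conjgE mulgA (conjgC _ i) conjVg conjXg it expVgn invgK.
  by rewrite -mulgA -expgnDr.
exists (i * t ^+ (a + a)), (i * t ^+ a), (u * i), e; split;
  [split | split | split | |].
- exact: involution_dilate.
- by rewrite -{1}[i]mulg1 -(expg0 t) => /dilate_inj e0; have := e0 Ii Ij ij; lia.
- rewrite -{2}[i]mul1g => /mulIg /mulg1_eq; rewrite invgK => cc.
  have : b = a by apply: (dilate_inj i j) => //; rewrite -tca -tcb cc.
  by rewrite /a; lia.
- exact: centralizerM.
- exact: ie.
- exact: ik.
- by rewrite -ik -conjgM involution_mulgg // conjg1.
- have -> : (u * i) ^ (i * t ^+ a) = u * i * t ^+ (b + a).
    rewrite conjgM (conjMg u i i) (conjg_fix_sym _ _ iu) iii.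
    rewrite conjgE mulgA (conjgC _ (u * i)) conjVg conjgM tau conjXg it expVgn invgK.
    by rewrite -mulgA -expgnDr.
  rewrite conjMg ie (expgnDr t a a) conjMg tae -expgnDr !mulgA.
  by rewrite -(mulgA u i i) ii mulg1; congr (_ * _ ^+ _); rewrite /a /h; lia.
- have [|s sP] := finite_conjugates (centralizer i) A u sA abA finA Ab.
    by move=> g; apply: centralizerV.
  exists [seq x * i | x <- s] => g ig.
  apply/mapP; exists (u ^ g); first exact: sP.
  by rewrite conjMg ig.
- have [|s sP] := finite_conjugates (centralizer i) A e sA abA finA Ah.
    by move=> g; apply: centralizerV.
  by exists s => g ig; apply: sP.
Qed.

(** * Covering the involutions by finitely many inverted sets *)

(** Transporting [c] and [e] by an element taking [(i, y)] to [(x, z)] gives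
    [c_xz] and [e_xz], and the hypothesis on [c ^ k] becomes
    [c_zx = c_xz * x * z ^ e_xz].  Among [(size s).+1] involutions [x] two share
    the value [c_zx], and then [z ^ e_xz * z ^ e_x'z] is a translation inverted
    by [z ^ e_xz] and taken from a finite set.  It is nontrivial because
    [x * c_xz^-1] fixes only [x]. *)
Lemma finite_cover i y k (c e : G) (s s' : seq G) :
  [/\ involution i, involution y, i <> y & c <> i] -> i ^ c = i /\ i ^ e = i ->
  [/\ i ^ k = y, y ^ k = i & c ^ k = c * i * y ^ e] ->
  (forall g, i ^ g = i -> c ^ g \in s) ->
  (forall g, i ^ g = i -> e ^ g \in s') ->
  exists L ts, (forall t, t \in ts -> translation t) /\
    forall z, involution z -> z \in L \/ exists2 t, t \in ts & inverts z t.
Proof.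
move=> [Ii Iy iy ci] [ic ie] [ik yk ck] sP s'P.
pose x n := i * (i * y) ^+ n.
have Ix n : involution (x n) by apply: involution_dilate.
have x_inj n m : n < m -> x n <> x m.
  by move=> lt_nm /dilate_inj e0; have := e0 Ii Iy iy; lia.
have /choice [h hP] : forall n, exists g, i ^ g = x n.
  move=> n; have [g [ig _]] := involution_2trans _ sG i y (x n) (x n.+1)
    Ii Iy (Ix n) (Ix n.+1) iy (x_inj n n.+1 (ltnSn n)).
  by exists g.
have shift n g : i ^ g = x n -> i ^ (g * (h n)^-1) = i.
  by move=> ig; rewrite conjgM ig -(hP n) conjgK.
pose r := iota 0 (size s).+1.
pose Q := [seq x n * (c1 ^ h n)^-1 | n <- r, c1 <- s].
pose E := [seq e1 ^ h n | n <- r, e1 <- s'].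
pose T := [seq (q.1 * q.2^-1) ^ w^-1
  | q <- [seq (q1, q2) | q1 <- Q, q2 <- Q], w <- E].
exists [seq x n | n <- r], [seq t <- T | `[< translation t >]].
split=> [t|z Iz]; first by rewrite mem_filter => /andP [/asboolP].
have [zL|zL] := boolP (z \in [seq x n | n <- r]); [by left | right].
have xz n : n <= size s -> x n <> z.
  move=> le_n xnz; move: zL; rewrite -xnz map_f // mem_iota add0n ltnS.
  by rewrite le_n.
have /choice [g gP] : forall n, exists g, n <= size s -> i ^ g = x n /\ y ^ g = z.
  move=> n; have [/xz ne|] := boolP (n <= size s); last by exists 1.
  have [g gP] := involution_2trans _ sG _ _ _ _ Ii Iy (Ix n) Iz iy ne.
  by exists g.
pose w := k * g 0; have iw : i ^ w = z by rewrite conjgM ik; have [] := gP 0.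
(* [c' n] is the dilation [c_zx] with centre [z] in the direction of [x n]. *)
pose c' n := c ^ (k * g n).
have c's n : n <= size s -> c' n \in [seq c1 ^ w | c1 <- s].
  move=> /gP [_ yg]; apply/mapP; exists (c ^ (k * g n * w^-1)).
    by apply: sP; rewrite conjgM (conjgM i) ik yg -iw conjgK.
  by rewrite -conjgM mulgVK.
pose q n := x n * (c ^ g n)^-1.
have qE n : n <= size s -> z ^ (e ^ g n) = q n * c' n.
  move=> /gP [ig yg].
  have -> : c' n = c ^ g n * x n * z ^ (e ^ g n).
    by rewrite /c' conjgM ck (conjMg (c * i)) (conjMg c i) ig (conjJg y) yg.
  by rewrite /q -(mulgA (x n)) -(mulgA (c ^ g n)) mulKg mulgA;
  rewrite involution_mulgg // mul1g.
have [n [m [lt_nm le_m cc]]] : exists n m, [/\ n < m, m <= size s & c' n = c' m].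
  have := pigeonhole _ [seq c1 ^ w | c1 <- s] c'; rewrite size_map; exact.
have le_n : n <= size s := leq_trans (ltnW lt_nm) le_m.
have [[ign _] [igm _]] := (gP n le_n, gP m le_m).
have Ize l : involution (z ^ (e ^ g l)) by apply: involutionJ.
have qx l : l <= size s -> x l ^ q l = x l.
  move=> /gP [ig _]; rewrite conjgM (conjgE _ (x l)) mulKg.
  by apply: centralizerV; rewrite -ig -conjJg ic.
pose t := (q n * (q m)^-1) ^ (e ^ g n)^-1.
have tE : q n * (q m)^-1 = z ^ (e ^ g n) * z ^ (e ^ g m).
  rewrite -[z ^ (e ^ g m)](involution_invg _ (Ize m)) !qE //.
  by rewrite cc mulgKA.
exists t; last first.
  rewrite -[z](conjgK (e ^ g n)); apply: invertsJ; rewrite tE.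
  exact: inverts_mulg.
have qQ l : l <= size s -> q l \in Q.
  move=> le_l; have [ig _] := gP l le_l; apply/allpairsP.
  exists (l, c ^ (g l * (h l)^-1)); split=> /=.
  - by rewrite mem_iota add0n ltnS.
  - by apply: sP; apply: shift.
  - by rewrite -conjgM mulgVK.
rewrite mem_filter; apply/andP; split.
  apply/asboolP; exists z, (z ^ (e ^ g m * (e ^ g n)^-1)); split=> //.
  - exact: involutionJ.
  - move=> zz; suff ee : z ^ (e ^ g n) = z ^ (e ^ g m).
      have qq : q n = q m by move: ee; rewrite !qE // cc => /mulIg.
      have q1 : q n = 1.
        apply: (involution_free _ sG (x n) (x m)) => //; first exact: x_inj.
          exact: qx.
        by rewrite qq; apply: qx.
      move: q1; rewrite /q => /mulg1_eq/invg_inj; rewrite -ign => /conjg_inj.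
      by move/esym.
    by rewrite {1}zz -conjgM mulgVK.
  - by rewrite /t tE conjMg conjgK -conjgM.
apply/allpairsP; exists ((q n, q m), e ^ g n); split=> //=.
  by apply/allpairsP; exists (q n, q m); split=> //=; apply: qQ.
apply/allpairsP; exists (n, e ^ (g n * (h n)^-1)); split=> /=.
- by rewrite mem_iota add0n ltnS.
- by apply: s'P; apply: shift.
- by rewrite -conjgM mulgVK.
Qed.

(** Place [i] and [j] at [0] and [N] on a line of involutions, with [N] a
    multiple of all differences of a difference-dividing set.  Among sufficiently
    many points of the line with coordinates in that set, two invert the same
    [t], and by divisibility [i] and [j] belong to the progression that they
    span. *)
Lemma common_inverted L ts i j :
  (forall k, involution k -> k \in L \/ exists2 t, t \in ts & inverts k t) ->
  involution i -> involution j -> i <> j ->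
  exists t, [/\ t \in ts, inverts i t & inverts j t].
Proof.
move=> cover Ii Ij ij.
have [D [sz_D u_D D0 DP]] := difference_dividing_set (size L + size ts).+1.
pose N := (\max_(u <- D) u)`!.
have [k [Ik ik kN]] := translation_root i j N Ii Ij ij (fact_gt0 _).
pose p n := i * (i * k) ^+ nth 0 D n.
(* Colour a point by itself if it is an exception in [L], and otherwise by
   some [t] that it inverts. *)
pose R n (x : G + G) :=
  match x with inl l => p n = l | inr t => inverts (p n) t end.
pose s : seq (G + G)%type := map inl L ++ map inr ts.
have /choice [f fP] : forall n, exists x, x \in s /\ R n x.
  move=> n; have [|pL|[t tts pt]] := cover (p n).
  - exact: involution_dilate.
  - by exists (inl (p n)); rewrite mem_cat map_f.
  - by exists (inr t); rewrite mem_cat (map_f inr) ?orbT.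
have [n [m [lt_nm le_m eqf]]] := pigeonhole _ s f (fun n _ => (fP n).1).
have sz_s : size s = size L + size ts by rewrite size_cat !size_map.
have lt_m : m < size D by rewrite sz_D ltnS -sz_s.
have lt_n := ltn_trans lt_nm lt_m.
have neD : nth 0 D n <> nth 0 D m.
  by move=> /eqP; rewrite nth_uniq // => /eqP e; rewrite e ltnn in lt_nm.
have [[fs fn] [_ fm]] := (fP n, fP m); move: fs fn fm; rewrite -eqf.
case: (f n) => [l _ /= <- /dilate_inj e | t].
  by case: neD; symmetry; apply: e.
rewrite mem_cat => /orP [/mapP [] // | /mapP [t' tts [e]]] /= pn pm.
rewrite -e in tts.
have dvdN u v : v \in D -> u < v -> (v - u %| N)%N.
  move=> vD lt_uv; apply: dvdn_fact; rewrite subn_gt0 lt_uv /=.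
  by apply: leq_trans (leq_subr _ _) _; apply: leq_bigmax_seq.
have jN : j = i * (i * k) ^+ N by rewrite kN mulgA involution_mulgg // mul1g.
have ends u v : u \in D -> v \in D -> u < v ->
    inverts (i * (i * k) ^+ u) t -> inverts (i * (i * k) ^+ v) t ->
    inverts i t /\ inverts j t.
  move=> uD vD lt_uv; rewrite jN; apply: inverts_both_ends => //.
  - exact: inverts_mulg.
  - exact: DP.
  - exact: dvdN.
have [nD mD] := (mem_nth 0 lt_n, mem_nth 0 lt_m).
suff [it jt] : inverts i t /\ inverts j t by exists t.
by case: (ltngtP (nth 0 D n) (nth 0 D m)) => // lt;
  [apply: (ends _ _ nD mD) | apply: (ends _ _ mD nD)].
Qed.

(** If some [z] does not invert the head [t] of the list, every [k] shares with
    [z] a member of the tail; hence the tail covers all involutions but [z],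
    and [common_inverted] recovers the hypothesis on pairs for the tail. *)
Lemma inverted_by_all ts :
  (exists i j : G, [/\ involution i, involution j & i <> j]) ->
  (forall i j, involution i -> involution j -> i <> j ->
    exists t, [/\ t \in ts, inverts i t & inverts j t]) ->
  exists2 t, t \in ts & forall k, involution k -> inverts k t.
Proof.
move=> [i0 [j0 [Ii0 Ij0 ij0]]]; elim: ts => [|t ts IH] pairs.
  by have [t []] := pairs i0 j0 Ii0 Ij0 ij0.
have [all_t|/existsNP [z /not_implyP [Iz zt]]] :=
  pselect (forall k, involution k -> inverts k t).
  by exists t; rewrite ?mem_head.
have [|t' t'ts all_t'] := IH; last by exists t'; rewrite // inE t'ts orbT.
move=> i j; apply: (common_inverted [:: z]) => k Ik.
have [->|/eqP kz] := eqVneq k z; first by left; rewrite mem_head.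
have [t' []] := pairs z k Iz Ik (nesym kz).
by rewrite inE => /orP [/eqP -> //|t'ts] _ kt'; right; exists t'.
Qed.

(** All translations are conjugate, so it suffices that every involution inverts
    the one found by [inverted_by_all]. *)
Lemma translations_inverted (i0 j0 : G) (A : set G) :
  involution i0 -> involution j0 -> i0 <> j0 ->
  is_subgroup A -> is_abelian A -> (A `<=` centralizer i0)%classic ->
  finite_index (centralizer i0) A ->
  forall i j k, involution i -> involution j -> involution k -> inverts k (i * j).
Proof.
move=> Ii0 Ij0 ij0 sA abA Ai finA i j k Ii Ij Ik.
have [y [l [c [e [[Iy iy ci] fix_i rel [s sP] [s' s'P]]]]]] :=
  dilation_relation i0 j0 A Ii0 Ij0 ij0 sA abA Ai finA.
have [L [ts [tsP cover]]] :=
  finite_cover i0 y l c e s s' (And4 Ii0 Iy iy ci) fix_i rel sP s'P.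
have [|a b Ia Ib ab|t /tsP [a [b [Ia Ib ab ->]]] inv_ab] := inverted_by_all ts.
- by exists i0, j0.
- exact: common_inverted cover Ia Ib ab.
have [->|/eqP ij] := eqVneq i j.
  by rewrite /inverts involution_mulgg // conj1g invg1.
have [g [<- <-]] := involution_2trans _ sG a b i j Ia Ib Ii Ij ab ij.
rewrite -conjMg -[k](conjgKV g); apply: invertsJ; apply: inv_ab.
exact: involutionJ.
Qed.

End Sharp.

(** * From points to involutions and back *)

Section Action.
Context {G : groupType} {X : Type} {act : G -> X -> X}.
Context (hX : exists x y : X, x <> y)
    (hact : is_action act)
    (h2 : sharply_2_transitive act)
    (hchar : perm_char_0 act).

Lemma act_inj g x y : act g x = act g y -> x = y.
Proof.
have [act1 actM] := hact.
by move=> /(congr1 (act g^-1)); rewrite -!actM mulVg !act1.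
Qed.

Lemma act_fix2 g x y : x <> y -> act g x = x -> act g y = y -> g = 1.
Proof.
move=> xy gx gy; have [h [_ uh]] := h2 x y x y xy xy.
by rewrite -(uh g) // (uh 1) //; split; apply: hact.1.
Qed.

Lemma swap_involution x y : x <> y ->
  exists i, [/\ involution i, act i x = y & act i y = x].
Proof.
move=> xy; have [i [[ix iy] _]] := h2 x y y x xy (nesym xy).
exists i; split=> //; split.
  by move=> i1; apply: xy; rewrite -ix i1 hact.1.
by apply: (act_fix2 _ x y) => //; rewrite expg2 hact.2 ?ix ?iy.
Qed.

Lemma involution_fixed_point_unique i x y :
  involution i -> act i x = x -> act i y = y -> x = y.
Proof.
move=> [i1 _] ix iy; apply: contrapT => xy; apply: i1.
exact: act_fix2 xy ix iy.
Qed.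

Lemma act_conj g h x : act h (act g x) = act g (act (h ^ g) x).
Proof. by rewrite -!hact.2 conjgC. Qed.

Lemma act_sharp g h x y :
  x <> y -> act g x = act h x -> act g y = act h y -> g = h.
Proof.
move=> xy egx egy; have gxy : act g x <> act g y by move/act_inj.
have [k [_ uk]] := h2 _ _ _ _ xy gxy.
by rewrite -(uk g) // (uk h).
Qed.

Lemma act_transitive x y : exists g, act g x = y.
Proof.
have [<-|xy] := pselect (x = y); first by exists 1; apply: hact.1.
by have [i [_ ix _]] := swap_involution _ _ xy; exists i.
Qed.

Lemma involution_at x : exists2 i, involution i & act i x = x.
Proof.
have [a [b ab]] := hX; have [i [Ii _ _]] := swap_involution _ _ ab.
have [z iz] := hchar.1 i Ii; have [g gx] := act_transitive x z.
exists (i ^ g); first exact: involutionJ.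
by apply: (act_inj g); rewrite -act_conj gx.
Qed.

(** Two involutions fixing [x] can be compared on a pair they move.  If [g]
    takes [(y, i y)] to [(y, j y)], then [i] and [j ^ g] agree on that
    pair, so they are equal; the fixed point of [j ^ g] shows that [g] fixes
    [x], as well as [y]. *)
Lemma involution_at_unique i j x :
  involution i -> involution j -> act i x = x -> act j x = x -> i = j.
Proof.
move=> Ii Ij ix jx.
have [y xy] : exists y, x <> y.
  have [a [b ab]] := hX; have [xa|] := pselect (x = a); last by exists a.
  by exists b; rewrite xa.
have moved k : involution k -> act k x = x -> y <> act k y.
  by move=> Ik kx /esym ky; apply: xy; apply: (involution_fixed_point_unique k).
have invol k z : involution k -> act k (act k z) = z.
  by move=> Ik; rewrite -hact.2 involution_mulgg // hact.1.
have [g [[gy gi] _]] := h2 _ _ _ _ (moved i Ii ix) (moved j Ij jx).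
have eij : i = j ^ g.
  apply: (act_sharp _ _ _ _ (moved i Ii ix)); apply: (act_inj g).
    by rewrite -act_conj gi gy.
  by rewrite -act_conj gi !invol // gy.
have gx : act g x = x.
  apply: (involution_fixed_point_unique j) => //.
  by rewrite act_conj -eij ix.
by rewrite eij (act_fix2 g x y) // conjg1.
Qed.

Lemma sharp_involutions_of_action : sharp_involutions G.
Proof.
split; first exact: hchar.2.
- move=> i j i' j' Ii Ij Ii' Ij' ij ij'.
  have [[x ix] [y jy]] := (hchar.1 i Ii, hchar.1 j Ij).
  have [[x' ix'] [y' jy']] := (hchar.1 i' Ii', hchar.1 j' Ij').
  have xy : x <> y.
    by move=> e; apply: ij; apply: (involution_at_unique _ _ x); rewrite // e.
  have xy' : x' <> y'.
    by move=> e; apply: ij'; apply: (involution_at_unique _ _ x'); rewrite // e.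
  have [g [[gx gy] _]] := h2 _ _ _ _ xy' xy.
  exists g; split.
    apply: (involution_at_unique _ _ x') => //; first exact: involutionJ.
    by apply: (act_inj g); rewrite -act_conj gx.
  apply: (involution_at_unique _ _ y') => //; first exact: involutionJ.
  by apply: (act_inj g); rewrite -act_conj gy.
move=> i j g Ii Ij ij ig jg.
have fix_g k x : involution k -> k ^ g = k -> act k x = x -> act g x = x.
  move=> Ik kg kx; apply: (involution_fixed_point_unique k) => //.
  by rewrite act_conj kg kx.
have [[x ix] [y jy]] := (hchar.1 i Ii, hchar.1 j Ij).
apply: (act_fix2 g x y); [|exact: (fix_g i)|exact: (fix_g j)].
by move=> e; apply: ij; apply: (involution_at_unique _ _ x); rewrite // e.
Qed.

Lemma stabilizer_centralizer i x :
  involution i -> act i x = x -> stabilizer act x = centralizer i.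
Proof.
move=> Ii ix; apply/seteqP; split=> g /= gx.
  apply: (involution_at_unique _ _ x) => //; first exact: involutionJ.
  by apply: (act_inj g); rewrite -act_conj gx.
apply: (involution_fixed_point_unique i) => //.
by rewrite act_conj gx ix.
Qed.

(** If [i] inverts [j * k], then [i * (j * k)] is an involution; this closes the
    set of products of two involutions under division.  A nontrivial such product
    fixing [x] would commute with the involution that fixes [x] and also be
    inverted by it, hence have order 2. *)
Lemma splits_of_inverted_translations :
  (forall i j k : G, involution i -> involution j -> involution k ->
    inverts k (i * j)) ->
  splits act.
Proof.
move=> inv; have sG := sharp_involutions_of_action.
have prod3 (i j k : G) : involution i -> involution j -> involution k ->
    involution (i * (j * k)).
  move=> Ii Ij Ik; have [->|/eqP jk] := eqVneq j k.
    by rewrite involution_mulgg // mulg1.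
  rewrite -[j * k]expg1; apply: involution_mulX => //; first exact: inv.
  exact: (translation_order _ sG).
pose N : set G :=
  [set g | exists i j, [/\ involution i, involution j & g = i * j]]%classic.
exists N; split; first split; first split.
- apply/mem_set; have [a _] := hX; have [i Ii _] := involution_at a.
  by exists i, i; rewrite involution_mulgg.
- move=> _ _ /set_mem [i [j [Ii Ij ->]]] /set_mem [k [l [Ik Il ->]]].
  apply/mem_set; exists (l * (j * i)), k; split=> //; first exact: prod3.
  rewrite -(involution_invg (l * (j * i))); last exact: prod3.
  by rewrite !invgM !involution_invg // !mulgA.
- move=> g _ [i [j [Ii Ij ->]]]; exists (i ^ g), (j ^ g).
  by split; [exact: involutionJ | exact: involutionJ | exact: conjMg].
split=> [x y|x].
  have [i Ii ix] := involution_at x.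
  have [<-|xy] := pselect (x = y).
    by exists 1; [exists i, i; rewrite involution_mulgg | apply: hact.1].
  have [k [Ik kx _]] := swap_involution _ _ xy.
  by exists (k * i); [exists k, i | rewrite hact.2 ix].
apply/seteqP; split=> [_ [[i [j [Ii Ij ->]]] /= ijx]|_ ->]; last first.
  have [i Ii _] := involution_at x.
  by split; [exists i, i; rewrite involution_mulgg | apply: hact.1].
have [->|/eqP ij] := eqVneq i j; first by rewrite involution_mulgg.
have [k Ik kx] := involution_at x.
have kij : k ^ (i * j) = k.
  have [] : stabilizer act x (i * j) by [].
  by rewrite (stabilizer_centralizer k x).
have := inv i j k Ii Ij Ik; rewrite /inverts (conjg_fix_sym _ _ kij) => e.
by case: (translation_order _ sG i j Ii Ij ij 2) => //; rewrite expg2 {1}e mulVg.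
Qed.

End Action.

Theorem corollary6 (G : groupType) (X : Type) (act : G -> X -> X)
    (hX : exists x y : X, x <> y)
    (hG : permutation_group act)
    (h2 : sharply_2_transitive act)
    (hchar : perm_char_0 act)
    (x0 : X) (hstab : virtually_abelian (stabilizer act x0)) :
  splits act.
Proof.
have [hact _] := hG.
have [A [sA Ai abA finA]] := hstab.
have [i Ii ix] := involution_at hX hact h2 hchar x0.
rewrite (stabilizer_centralizer hX hact h2 i x0) // in Ai finA.
have sG := sharp_involutions_of_action hX hact h2 hchar.
have [y xy] : exists y, x0 <> y.
  have [a [b ab]] := hX; have [xa|] := pselect (x0 = a); last by exists a.
  by exists b; rewrite xa.
have [j Ij jy] := involution_at hX hact h2 hchar y.
have ij : i <> j.
  move=> e; apply: xy; apply: (involution_fixed_point_unique hact h2 i) => //.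
  by rewrite e.
apply: splits_of_inverted_translations => //.
exact: (translations_inverted sG i j A).
Qed.
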